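(* Let $\epsilon>0$ be fixed. Let $d,k$ be integers with $d<2^{\epsilon k/5}$, and let $f:(\mathbb{F}_2^k)^d\to\mathbb{F}_2$ be a uniformly random $d$-linear form. Then $$\Pr\left[\mathrm{bias}(f)\ge 2^{-(1-\epsilon)k}\right]\le 2^{-\Omega(\epsilon^2k^d)}.$$
   Context: A $d$-linear form $f:(\mathbb{F}_2^k)^d\to\mathbb{F}_2$ is a map linear in each of its $d$ arguments, i.e. $f(x_1,\dots,x_d)=\sum_{(i_1,\dots,i_d)\in[k]^d}T(i_1,\dots,i_d)\,x_{1,i_1}\cdots x_{d,i_d}$ for a tensor $T:[k]^d\to\mathbb{F}_2$; uniformly random means all entries of $T$ are independent uniform bits. $\mathrm{bias}(f)=\left|\mathbb{E}_{x_1,\dots,x_d\in\mathbb{F}_2^k}(-1)^{f(x_1,\dots,x_d)}\right|$. The $\Omega(\cdot)$ hides an absolute positive constant. *)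

(* Defs.v *)
From HB Require Import structures.
From mathcomp Require Import all_boot all_order all_algebra.
From mathcomp Require Import all_classical all_reals all_analysis.

Set Implicit Arguments.
Unset Strict Implicit.
Unset Printing Implicit Defensive.

Import Order.TTheory GRing.Theory Num.Theory.

Local Open Scope ring_scope.

(* A multi-index (i_1, ..., i_d) of [k]^d is a function 'I_d -> 'I_k. *)
Definition tensor (d k : nat) : finType := {ffun {ffun 'I_d -> 'I_k} -> 'F_2}.

Definition vectors (d k : nat) : finType := {ffun 'I_d -> 'rV['F_2]_k}.

Definition mlform (d k : nat) (T : tensor d k) (x : vectors d k) : 'F_2 :=
  \sum_(i : {ffun 'I_d -> 'I_k}) T i * \prod_(j < d) x j 0 (i j).

Definition expect (R : realType) (A : finType) (g : A -> R) : R :=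
  (\sum_(a : A) g a) / #|A|%:R.

(* Applied to [tensor d k], the uniform measure on A is exactly the law under
   which the entries of the tensor are independent uniform bits. *)
Definition prob (R : realType) (A : finType) (P : pred A) : R :=
  #|P|%:R / #|A|%:R.

(* The exponent is the representative in {0, 1} of the element f x of F_2. *)
Definition bias (R : realType) (d k : nat) (f : vectors d k -> 'F_2) : R :=
  `| expect (fun x : vectors d k => (-1) ^+ nat_of_ord (f x) : R) |.

(* Main.v *)
From HB Require Import structures.
From mathcomp Require Import all_boot all_order all_algebra all_field.
From mathcomp Require Import all_classical all_reals all_analysis.
From mathcomp Require Import ring lra.
Require Import Defs.

Set Implicit Arguments.
Unset Strict Implicit.
Unset Printing Implicit Defensive.

Import Order.TTheory GRing.Theory Num.Theory.

Local Open Scope ring_scope.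

(* Markov's inequality is applied to the n-th moment of the bias, with n of
   order eps k^(d-1).  As the bias equals its signed expectation, averaging over
   the tensor turns this moment into the probability that n random rank-one
   tensors of order d sum to 0.  Split each of them as y ⊗ u with u of order
   D = d-1 and reveal them one by one, keeping a subspace U of order-D tensors:
   either u lies in U, or at most one y is admissible and u is added to U.  So
   the moment is at most (p + 2^-k)^n, where p bounds the probability that u lies
   in a given subspace of dimension r < n.

   For p one shows that at most (2^k-1)^(D-1) (2^(r/k^(D-1)) - 1) tuples of nonzero
   vectors have their tensor product in U; this is tight for U = V ⊗ W with V a
   space of vectors and W full, so that nothing is lost when D grows.
   The induction on D needs: if 0 <= phi <= k on F_2^k and sum phi <= s over
   every linearly independent family, then the mean of 2^phi over the nonzero
   vectors is at most 2^(s/k); here phi x is the normalized dimension of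
   {w | x ⊗ w in U}. *)

(** * Convexity and exponential sums over the complement of a subspace *)

Lemma powR2D (R : realType) (x y : R) : 2 `^ (x + y) = 2 `^ x * 2 `^ y.
Proof. by rewrite powRD // pnatr_eq0 implybT. Qed.

Lemma ler_powR2 (R : realType) (x y : R) : x <= y -> 2 `^ x <= 2 `^ y.
Proof. by apply: ler_powR; rewrite ler1n. Qed.

(** The tangent to 2^x at the convex combination lies below the graph; averaging it at [a] and [b]
    cancels the slope. *)
Lemma powR2_convex (R : realType) (l a b : R) : 0 <= l <= 1 ->
  2 `^ ((1 - l) * a + l * b) <= (1 - l) * 2 `^ a + l * 2 `^ b.
Proof.
case/andP=> l0 l1; set m := _ + l * b.
have tangent (c : R) : 2 `^ m * (1 + (c - m) * ln 2) <= 2 `^ c.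
  rewrite [X in _ <= _ `^ X](_ : c = m + (c - m)); last by ring.
  rewrite (powR2D m) ler_wpM2l ?powR_ge0 //.
  by rewrite [leRHS]/powR pnatr_eq0 expR_ge1Dx.
have l1' : 0 <= 1 - l by rewrite subr_ge0.
have := lerD (ler_wpM2l l1' (tangent a)) (ler_wpM2l l0 (tangent b)).
apply: le_trans; rewrite le_eqVlt; apply/orP; left; apply/eqP.
rewrite /m; ring.
Qed.

Lemma card_vspaceF2 (k : nat) (W : {vspace 'rV['F_2]_k}) : #|W| = (2 ^ \dim W)%N.
Proof. by rewrite card_vspace card_Fp. Qed.

(* Jensen's inequality for [u |-> u ^ l]; the slack [A - #|P|] is a mass sitting at [phi = 0]. *)
Lemma sum_powR2_scale (R : realType) (T : finType) (P : pred T) (phi : T -> R)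
    (A l v : R) :
  0 <= l <= 1 -> #|P|%:R <= A ->
  \sum_(x | P x) (2 `^ phi x - 1) <= A * (2 `^ v - 1) ->
  \sum_(x | P x) (2 `^ (l * phi x) - 1) <= A * (2 `^ (l * v) - 1).
Proof.
move=> l01 PA H; have /andP[l0 l1] := l01.
(* [B z] is affine in 2^z and meets 2^(l z) at z = v: it is the tangent to u^l at u = 2^v. *)
pose B (z : R) := (1 - l) * 2 `^ (l * v) + l * 2 `^ ((l - 1) * v + z).
have leB z : 2 `^ (l * z) <= B z.
  apply: le_trans (powR2_convex _ _ l01).
  by rewrite le_eqVlt; apply/orP; left; apply/eqP; congr (_ `^ _); ring.
have BE z : B z - 1 = (B 0 - 1) + l * 2 `^ ((l - 1) * v) * (2 `^ z - 1).
  by rewrite /B !powR2D powRr0; ring.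
have B0 : 0 <= B 0 - 1 by rewrite subr_ge0 (le_trans _ (leB 0)) // mulr0 powRr0.
apply: (@le_trans _ _ (\sum_(x | P x) (B (phi x) - 1))).
  by apply: ler_sum => x _; rewrite lerB.
under eq_bigr do rewrite BE.
rewrite big_split /= -mulr_sumr sumr_const -[_ *+ #|_|]mulr_natl.
apply: (@le_trans _ _ (A * (B 0 - 1) + l * 2 `^ ((l - 1) * v) * (A * (2 `^ v - 1)))).
  by apply: lerD; [rewrite ler_wpM2r | rewrite ler_wpM2l // mulr_ge0 ?powR_ge0].
rewrite le_eqVlt; apply/orP; left; apply/eqP.
rewrite /B addr0 (_ : l * v = (l - 1) * v + v); last by ring.
rewrite powR2D; ring.
Qed.

Lemma dim_addv_line (k : nat) (W : {vspace 'rV['F_2]_k}) (x : 'rV['F_2]_k) :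
  x \notin W -> \dim (W + <[x]>) = (\dim W).+1.
Proof.
move=> xW; rewrite dimv_disjoint_sum ?dim_vline.
  by case: (eqVneq x 0) xW => [->|_ _]; rewrite ?mem0v // addn1.
apply/eqP; rewrite -subv0; apply/subvP => y; rewrite memv_cap => /andP[yW /vlineP[c yE]].
move: yW; rewrite yE; have [->|c0] := eqVneq c 0; first by rewrite scale0r !mem0v.
by rewrite rpredZeq (negPf c0) (negPf xW).
Qed.

(* The rescaling makes the maximum of [phi] equal to [k]; its maximizer then
   accounts exactly for the first term of the sum over [W + <[x1]>]. *)
Lemma sum_powR2_compl (R : realType) (k : nat) (W : {vspace 'rV['F_2]_k})
    (phi : 'rV['F_2]_k -> R) (s : R) :
  (0 < k)%N ->
  (forall x, x \notin W -> 0 <= phi x <= k%:R) ->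
  (forall xs : seq 'rV['F_2]_k, \dim (W + <<xs>>) = (\dim W + size xs)%N ->
    \sum_(x <- xs) phi x <= s) ->
  \sum_(x | x \notin W) (2 `^ phi x - 1)
    <= 2 ^+ \dim W * (2 ^+ k - 1) * (2 `^ (s / k%:R) - 1).
Proof.
move=> k_gt0; have k0 : 0 < k%:R :> R by rewrite ltr0n.
have [n] := ubnP (k - \dim W)%N.
elim: n => // n IH in W phi s *; rewrite ltnS => ltn phi01 freeW.
have s0 : 0 <= s by have := freeW [::]; rewrite big_nil; apply; rewrite span_nil addv0 addn0.
have two_ge1 : 1 <= 2 :> R by rewrite ler1n.
have pow_ge0 m : 0 <= 2 ^+ m - 1 :> R by rewrite subr_ge0 exprn_ege1.
have pow2_ge0 r : 0 <= r -> 0 <= 2 `^ r - 1 :> R.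
  by move=> /ler_powR2; rewrite powRr0 subr_ge0.
have rhs_ge0 : 0 <= 2 ^+ \dim W * (2 ^+ k - 1) * (2 `^ (s / k%:R) - 1) :> R.
  by rewrite !mulr_ge0 ?exprn_ge0 ?pow2_ge0 ?divr_ge0 // ltW.
case: (pickP [pred x | x \notin W]) => [x0 /= x0W|Wall]; last by rewrite big_pred0.
pose x1 := [arg max_(x > x0 | x \notin W) phi x]%O.
have [x1W x1max] : x1 \notin W /\ forall x, x \notin W -> phi x <= phi x1.
  by rewrite /x1; case: arg_maxP.
have /andP[phi1_ge0 phi1_le] := phi01 _ x1W.
have [phi10|phi1N0] := eqVneq (phi x1) 0.
  rewrite big1 // => x xW; have /andP[phi_ge0 _] := phi01 x xW.
  suff -> : phi x = 0 by rewrite powRr0 subrr.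
  by apply/eqP; rewrite eq_le phi_ge0 -phi10 x1max.
have phi1_gt0 : 0 < phi x1 by rewrite lt_neqAle eq_sym phi1N0.
pose l := phi x1 / k%:R; have l0 : 0 < l by rewrite divr_gt0.
pose u x := phi x / l; have uE x : phi x = l * u x by rewrite /u mulrC divfK ?gt_eqF.
have ux1 : u x1 = k%:R by rewrite /u /l; field; rewrite phi1N0 /= gt_eqF.
under eq_bigr do rewrite uE.
have -> : s / k%:R = l * (s / l / k%:R) by field; rewrite !gt_eqF.
have u01 x : x \notin W -> 0 <= u x <= k%:R.
  move=> xW; have /andP[phi_ge0 _] := phi01 x xW.
  rewrite /u ler_pdivrMr // (mulrC k%:R) divfK ?gt_eqF // x1max // andbT.
  exact: divr_ge0 phi_ge0 (ltW l0).
have dW1 := dim_addv_line x1W; set W1 := (W + <[x1]>)%VS in dW1.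
have WW1 : {subset W <= W1} by apply/subvP; exact: addvSl.
have cardW1 : #|[predC W]|%:R = 2 ^+ k - 2 ^+ \dim W :> R.
  rewrite -[2 ^+ k](_ : #|{: 'rV['F_2]_k}|%:R = _); last first.
    by rewrite card_mx card_Fp // mul1n natrX.
  by rewrite -(cardC W) natrD card_vspaceF2 natrX addrAC subrr add0r.
apply: sum_powR2_scale.
- by rewrite ltW //= /l ler_pdivrMr // mul1r.
- rewrite cardW1 mulrBr mulr1 lerB // ler_peMl ?exprn_ge0 // exprn_ege1 //.
rewrite (bigID (mem W1)) /=.
have -> : \sum_(x | (x \notin W) && (x \notin W1)) (2 `^ u x - 1) =
          \sum_(x | x \notin W1) (2 `^ u x - 1).
  apply: eq_bigl => x; case: (boolP (x \in W1)) => [|xW1]; first by rewrite andbF.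
  by rewrite andbT; apply: contra xW1 => /WW1.
(* Prepending [x1] to a family independent modulo [W1] gives one independent modulo [W], and [x1]
   uses up [k] of the budget [s / l]. *)
have IH1 : \sum_(x | x \notin W1) (2 `^ u x - 1)
    <= 2 ^+ \dim W1 * (2 ^+ k - 1) * (2 `^ ((s / l - k%:R) / k%:R) - 1).
  apply: IH => [|x xW1|xs dxs].
  - have : (\dim W1 <= k)%N by rewrite (leq_trans (dimvS (subvf W1))) // dimvf /dim /= mul1n.
    by rewrite dW1 => dk; rewrite subnS (leq_trans _ ltn) // prednK // subn_gt0.
  - by apply: u01; apply: contra xW1 => /WW1.
  - have := freeW (x1 :: xs); rewrite span_cons addvA -/W1 dxs dW1 /= addSnnS.
    move=> /(_ erefl); rewrite big_cons => H.
    rewrite lerBrDr addrC ler_pdivlMr // mulrDl -ux1.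
    by rewrite mulr_suml; under eq_bigr do rewrite mulrC -uE; rewrite mulrC -uE.
have part1 : \sum_(x | (x \notin W) && (x \in W1)) (2 `^ u x - 1)
    <= 2 ^+ \dim W * (2 ^+ k - 1) :> R.
  apply: (@le_trans _ _ (\sum_(x | (x \notin W) && (x \in W1)) (2 ^+ k - 1))).
    apply: ler_sum => x /andP[xW _]; rewrite lerB // -powR_mulrn // ler_powR2 //.
    by have /andP[] := u01 x xW.
  rewrite sumr_const -[_ *+ #|_|]mulr_natl ler_wpM2r //.
  rewrite -(lerD2l (2 ^+ \dim W)) -[X in X + _](natrX R) -card_vspaceF2 -natrD.
  have -> : (#|W| + #|[pred x | (x \notin W) && (x \in W1)]|)%N = #|W1|.
    rewrite -(cardID W W1); congr (_ + _)%N.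
    by apply: eq_card => x; rewrite !inE; case: (boolP (x \in W)) => [/WW1 ->|]; rewrite ?andbF.
  by rewrite card_vspaceF2 dW1 natrX exprS mulr_natl mulr2n.
apply: le_trans (lerD part1 IH1) _.
(* With v = s / (l k) and dim W1 = dim W + 1, the second part doubles 2^(v-1) - 1 to 2^v - 2; the
   first part supplies the missing 1. *)
rewrite le_eqVlt; apply/orP; left; apply/eqP.
rewrite dW1 exprS mulrBl divff ?gt_eqF //.
have -> : 2 `^ (s / l / k%:R) = 2 `^ (s / l / k%:R - 1) * 2.
  by rewrite -[X in _ = _ * X](powRr1 (ltW _)) // -powR2D subrK.
ring.
Qed.

(** * Tuples, tensors and their slices *)

Definition fcons (T : Type) (D : nat) (x : T) (u : {ffun 'I_D -> T}) :
    {ffun 'I_D.+1 -> T} :=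
  [ffun j => if unlift ord0 j is Some j' then u j' else x].

Definition fbehead (T : Type) (D : nat) (f : {ffun 'I_D.+1 -> T}) :
    {ffun 'I_D -> T} :=
  [ffun j => f (lift ord0 j)].

Lemma fcons0 (T : Type) (D : nat) (x : T) (u : {ffun 'I_D -> T}) :
  fcons x u ord0 = x.
Proof. by rewrite ffunE unlift_none. Qed.

Lemma fconsS (T : Type) (D : nat) (x : T) (u : {ffun 'I_D -> T}) j :
  fcons x u (lift ord0 j) = u j.
Proof. by rewrite ffunE liftK. Qed.

Lemma fconsK (T : Type) (D : nat) (x : T) (u : {ffun 'I_D -> T}) :
  fbehead (fcons x u) = u.
Proof. by apply/ffunP => j; rewrite ffunE fconsS. Qed.

Lemma fcons_bij (T : Type) (D : nat) :
  bijective (fun p : T * {ffun 'I_D -> T} => fcons p.1 p.2).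
Proof.
exists (fun f : {ffun 'I_D.+1 -> T} => (f ord0, fbehead f)) => [[x u]|f] /=.
  by rewrite fcons0 fconsK.
by apply/ffunP => j; rewrite ffunE; case: unliftP => [j' ->|->]; rewrite ?ffunE.
Qed.

Lemma sum_fcons (R : nmodType) (T : finType) (D : nat)
    (F : {ffun 'I_D.+1 -> T} -> R) :
  \sum_f F f = \sum_x \sum_u F (fcons x u).
Proof.
by rewrite (reindex _ (onW_bij _ (fcons_bij T D))) /= -(pair_bigA _ (fun x u => F (fcons x u))).
Qed.

(** The regular module [('F_2)^o] as codomain makes these functions a vector space, so that
    [{vspace _}] and [\dim] apply. *)
Notation multitensor D k := {ffun {ffun 'I_D -> 'I_k} -> ('F_2)^o}.

Definition rank1 (D k : nat) (x : vectors D k) : multitensor D k :=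
  [ffun i : {ffun 'I_D -> 'I_k} => \prod_(j < D) x j 0 (i j)].

Definition tensl (D k : nat) (x : 'rV['F_2]_k) (w : multitensor D k) :
    multitensor D.+1 k :=
  [ffun i : {ffun 'I_D.+1 -> 'I_k} => x 0 (i ord0) * w (fbehead i)].

Lemma rank1_fcons (D k : nat) (x : 'rV['F_2]_k) (u : vectors D k) :
  rank1 (fcons x u) = tensl x (rank1 u).
Proof.
apply/ffunP => i; rewrite !ffunE big_ord_recl fcons0; congr (_ * _).
by apply: eq_bigr => j _; rewrite fconsS ffunE.
Qed.

Lemma tensl_is_linear (D k : nat) (x : 'rV['F_2]_k) : linear (@tensl D k x).
Proof.
move=> a v w; apply/ffunP => i; rewrite !ffunE /GRing.scale /=.
by rewrite mulrDr mulrCA.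
Qed.

HB.instance Definition _ (D k : nat) (x : 'rV['F_2]_k) :=
  GRing.isLinear.Build 'F_2 (multitensor D k) (multitensor D.+1 k) _ (@tensl D k x)
    (tensl_is_linear x).

Lemma tensl_fcons (D k : nat) (x : 'rV['F_2]_k) (w : multitensor D k) a i :
  tensl x w (fcons a i) = x 0 a * w i.
Proof. by rewrite ffunE fcons0 fconsK. Qed.

Definition slice (D k : nat) (U : {vspace multitensor D.+1 k}) (x : 'rV['F_2]_k) :
    {vspace multitensor D k} :=
  (linfun (@tensl D k x) @^-1: U)%VS.

Lemma mem_slice (D k : nat) (U : {vspace multitensor D.+1 k}) x w :
  (w \in slice U x) = (tensl x w \in U).
Proof. by rewrite -memv_preim lfunE. Qed.

(** For independent [xs] the maps w -> x ⊗ w are injective with independent images; they send the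
    slices into [U], where the dimensions add up. *)
Lemma sum_dim_slice (D k : nat) (U : {vspace multitensor D.+1 k}) (xs : seq 'rV['F_2]_k) :
  free xs -> (\sum_(x <- xs) \dim (slice U x) <= \dim U)%N.
Proof.
move=> fxs; rewrite (big_nth 0) big_mkord.
pose L (i : 'I_(size xs)) := linfun (@tensl D k xs`_i).
have indep (w : 'I_(size xs) -> multitensor D k) :
    \sum_(i < size xs) tensl xs`_i (w i) = 0 -> forall i, w i = 0.
  (* At a fixed multi-index [m] the vanishing sum is a linear relation among [xs] with coefficients
     [w i m]. *)
  move=> sum0 i; apply/ffunP => m; rewrite ffunE.
  apply: (freeP (X := in_tuple xs) fxs (fun i => w i m)) => /=.
  apply/rowP => a; rewrite summxE mxE.
  transitivity (\sum_(i' < size xs) tensl xs`_i' (w i') (fcons a m)).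
    by apply: eq_bigr => i' _; rewrite tensl_fcons mxE mulrC.
  by rewrite -sum_ffunE sum0 ffunE.
have kerL i : lker (L i) = 0%VS.
  apply/eqP; rewrite -subv0; apply/subvP => v; rewrite memv_ker lfunE memv0 => /eqP v0.
  have := indep (fun j => if j == i then v else 0).
  rewrite (bigD1 i) //= eqxx v0 add0r big1 => [/(_ erefl i)|j /negPf ->].
    by rewrite eqxx => ->.
  by rewrite linear0.
have dir : directv (\sum_(i < size xs) (L i @: slice U xs`_i)).
  apply/directv_sum_independent => us usL sum0 i _.
  have /fin_all_exists[w wE] : forall j : 'I_(size xs), exists w, us j = tensl xs`_j w.
    by move=> j; have /memv_imgP[w _ ->] := usL j isT; exists w; rewrite lfunE.
  rewrite wE (indep w) ?linear0 //.
  by rewrite -[RHS]sum0; apply: eq_bigr => j _; rewrite wE.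
have := dimvS (_ : (\sum_(i < size xs) (L i @: slice U xs`_i) <= U)%VS).
rewrite (directvP dir) /= => le.
under eq_bigr => i _ do rewrite -(limg_dim_eq (f := L i)) ?kerL ?capv0 //.
apply: le; apply/subv_sumP => i _.
by apply/subvP => _ /memv_imgP[w wU ->]; rewrite lfunE /= -mem_slice.
Qed.

(** * Counting rank-one tensors in a subspace *)

Lemma dim_multitensor (D k : nat) (U : {vspace multitensor D k}) : (\dim U <= k ^ D)%N.
Proof.
rewrite (leq_trans (dimvS (subvf U))) // dimvf /dim /= muln1.
by rewrite card_ffun !card_ord.
Qed.

(** Induction on [D]: the first vector [x] is fixed and the rest is counted in [slice U x]. Dividing
    by 2^k - 1 replaces the exponent D - 1, so that D = 0 makes sense. *)
Lemma card_nonzero_rank1 (R : realType) (D k : nat) (U : {vspace multitensor D k}) :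
  (0 < k)%N ->
  #|[pred x : vectors D k | [forall j, x j != 0] && (rank1 x \in U)]|%:R
    <= (2 ^+ k - 1) ^+ D / (2 ^+ k - 1)
       * (2 `^ (k%:R * (\dim U)%:R / k%:R ^+ D) - 1) :> R.
Proof.
move=> k_gt0; have k0 : 0 < k%:R :> R by rewrite ltr0n.
have c_gt0 : 0 < 2 ^+ k - 1 :> R by rewrite subr_gt0 exprn_egt1 // ?ltr1n // -lt0n.
elim: D U => [|D IH] U.
  rewrite expr0 mul1r divr1.
  have := dim_multitensor U; rewrite expn0 => dimU.
  have [dU0|dU1] : \dim U = 0%N \/ \dim U = 1%N by case: (\dim U) dimU => [|[]]; auto.
    rewrite dU0 mulr0 powRr0 subrr mulr0 lern0; apply/eqP.
    have /eqP := dU0; rewrite dimv_eq0 => /eqP ->.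
    apply: eq_card0 => x; rewrite !inE memv0; apply/negP => /andP[_ /eqP/ffunP].
    by move=> /(_ (ffun0 (card_ord 0))); rewrite !ffunE big_ord0 => /eqP; rewrite oner_eq0.
  rewrite dU1 mulr1 powR_mulrn // mulVf ?gt_eqF //.
  rewrite (_ : 1 = 1%:R) // ler_nat (leq_trans (max_card _)) //.
  by rewrite card_ffun card_ord expn0.
pose phi x : R := k%:R * (\dim (slice U x))%:R / k%:R ^+ D.
have -> : #|[pred x : vectors D.+1 k | [forall j, x j != 0] && (rank1 x \in U)]| =
    (\sum_(x : 'rV['F_2]_k | x != 0%R)
      #|[pred u : vectors D k | [forall j, u j != 0%R] && (rank1 u \in slice U x)]|)%N.
  rewrite -sum1_card big_mkcond /= sum_fcons [RHS]big_mkcond /=.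
  apply: eq_bigr => x _; case: ifP => x0.
    rewrite -sum1_card [RHS]big_mkcond /=; apply: eq_bigr => u _.
    rewrite !inE mem_slice rank1_fcons; congr (if _ && _ then _ else _).
    apply/forallP/forallP => [H j|H j]; first by have := H (lift ord0 j); rewrite fconsS.
    by case: (unliftP ord0 j) => [j' ->|->]; rewrite ?fconsS ?fcons0.
  apply: big1 => u _; rewrite inE; case: forallP => // /(_ ord0).
  by rewrite fcons0 x0.
rewrite natr_sum.
apply: (@le_trans _ _ ((2 ^+ k - 1) ^+ D / (2 ^+ k - 1) *
    \sum_(x : 'rV['F_2]_k | x != 0) (2 `^ phi x - 1))).
  by rewrite mulr_sumr; apply: ler_sum => x _; exact: IH.
rewrite exprSr [_ ^+ D * _ / _]mulrAC -[leRHS]mulrA.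
have c_ge0 := ltW c_gt0; apply: ler_wpM2l; first by rewrite divr_ge0 ?exprn_ge0.
(* With W = 0 the sum runs over the nonzero vectors; [dim_multitensor] gives phi <= k and
   [sum_dim_slice] bounds the independent families. *)
have := @sum_powR2_compl R k 0%VS phi (k%:R * (\dim U)%:R / k%:R ^+ D) k_gt0.
rewrite dimv0 expr0 mul1r => H.
have -> : k%:R * (\dim U)%:R / k%:R ^+ D.+1 = k%:R * (\dim U)%:R / k%:R ^+ D / k%:R :> R.
  by rewrite exprS invfM mulrA mulrAC.
under eq_bigl do rewrite -memv0.
apply: H => [x _|xs].
  apply/andP; split; first by rewrite divr_ge0 ?mulr_ge0 ?exprn_ge0 ?ler0n.
  rewrite ler_pdivrMr ?exprn_gt0 // ler_pM2l // -natrX ler_nat.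
  exact: dim_multitensor.
rewrite add0v add0n => fxs.
rewrite -mulr_suml -mulr_sumr -natr_sum ler_wpM2r ?invr_ge0 ?exprn_ge0 ?ler0n //.
rewrite ler_pM2l // ler_nat sum_dim_slice //.
by rewrite /free fxs.
Qed.

Lemma card_vectors (D k : nat) : #|vectors D k| = (2 ^ (k * D))%N.
Proof. by rewrite /vectors card_ffun card_mx card_Fp // card_ord mul1n expnM. Qed.

Lemma bernoulli_ge (R : realType) (y : R) (n : nat) :
  0 <= y <= 1 -> 1 - n%:R * y <= (1 - y) ^+ n.
Proof.
case/andP=> y0 y1; elim: n => [|n IH]; first by rewrite mul0r subr0 expr0.
rewrite exprS; apply: le_trans (ler_wpM2l _ IH); last by rewrite subr_ge0.
have : 0 <= n%:R * (y * y) by rewrite !mulr_ge0.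
by rewrite -natr1; nra.
Qed.

(** Tuples with a zero vector have proportion 1 - (1 - 2^-k)^D <= D / 2^k by Bernoulli;
    [card_nonzero_rank1] handles the others. *)
Lemma card_rank1 (R : realType) (D k : nat) (U : {vspace multitensor D k}) :
  (0 < k)%N ->
  #|[pred x : vectors D k | rank1 x \in U]|%:R
    <= 2 ^+ (k * D) * (D%:R / 2 ^+ k
         + (2 `^ (k%:R * (\dim U)%:R / k%:R ^+ D) - 1) / (2 ^+ k - 1)) :> R.
Proof.
move=> k_gt0; set E := 2 `^ _ - 1.
have c_gt0 : 0 < 2 ^+ k - 1 :> R by rewrite subr_gt0 exprn_egt1 // ?ltr1n // -lt0n.
have q_gt0 : 0 < 2 ^+ k :> R by rewrite exprn_gt0.
have E0 : 0 <= E.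
  by rewrite /E subr_ge0 -[leLHS](powRr0 2) ler_powR2 // divr_ge0 ?mulr_ge0 ?exprn_ge0.
have cardA : #|[pred x : vectors D k | [forall j, x j != 0]]|%:R = (2 ^+ k - 1) ^+ D :> R.
  have -> : #|[pred x : vectors D k | [forall j, x j != 0]]| =
      #|(ffun_on (predC1 (0 : 'rV['F_2]_k)) : pred {ffun 'I_D -> 'rV['F_2]_k})| by [].
  rewrite card_ffun_on cardC1 card_mx card_Fp // card_ord mul1n natrX -subn1 natrB ?natrX //.
  by rewrite expn_gt0.
pose Z := [pred x : vectors D k | ~~ [forall j, x j != 0]].
pose N := [pred x : vectors D k | [forall j, x j != 0] && (rank1 x \in U)].
have cardZ : #|Z|%:R = 2 ^+ (k * D) - (2 ^+ k - 1) ^+ D :> R.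
  rewrite -cardA -natrX -card_vectors -(cardC [pred x : vectors D k | [forall j, x j != 0]]).
  by rewrite natrD addrAC subrr add0r; congr (_%:R); apply: eq_card.
apply: (@le_trans _ _ (#|Z|%:R + #|N|%:R)).
  rewrite -natrD ler_nat -cardUI (leq_trans _ (leq_addr _ _)) //.
  apply: subset_leq_card; apply/fintype.subsetP => x; rewrite !inE => ->.
  by rewrite andbT orNb.
rewrite mulrDr; apply: lerD.
  have -> : #|Z|%:R = 2 ^+ (k * D) * (1 - (1 - (2 ^+ k)^-1) ^+ D) :> R.
    rewrite cardZ exprM mulrBr mulr1 -exprMn mulrBr mulr1 divff //.
  rewrite ler_wpM2l ?exprn_ge0 // lerBlDr -lerBlDl.
  apply: bernoulli_ge; rewrite invr_ge0 ltW //= invf_le1 // exprn_ege1 //.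
  by rewrite ler1n.
apply: le_trans (card_nonzero_rank1 R U k_gt0) _.
rewrite -/E mulrAC -mulrA; apply: ler_wpM2r; first exact: divr_ge0 E0 (ltW c_gt0).
by rewrite exprM lerXn2r ?nnegrE ?(ltW c_gt0) ?(ltW q_gt0) // gerBl.
Qed.

(** * Sums of random rank-one tensors *)

Definition slab (D k : nat) (a : 'I_k) (w : multitensor D.+1 k) : multitensor D k :=
  [ffun i => w (fcons a i)].

Lemma slab_rank1 (D k : nat) a (y : 'rV['F_2]_k) (u : vectors D k) :
  slab a (rank1 (fcons y u)) = y 0 a *: rank1 u.
Proof. by apply/ffunP => i; rewrite [LHS]ffunE rank1_fcons tensl_fcons [RHS]ffunE. Qed.

Lemma slabD (D k : nat) a (v w : multitensor D.+1 k) :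
  slab a (v + w) = slab a v + slab a w.
Proof. by apply/ffunP => i; rewrite !ffunE. Qed.

(** The sum of the [rank1 (z j)] lies in F_2^k ⊗ U. For U = 0 it vanishes; the induction on [t]
    needs a general [U]. *)
Definition sum_rank1_in (D k t : nat) (U : {vspace multitensor D k}) :
    pred {ffun 'I_t -> vectors D.+1 k} :=
  [pred z : {ffun 'I_t -> vectors D.+1 k} | [forall a, slab a (\sum_j rank1 (z j)) \in U]].

Lemma sum_rank1_in_fcons (D k t : nat) (U : {vspace multitensor D k}) y u
    (z : {ffun 'I_t -> vectors D.+1 k}) :
  sum_rank1_in U (fcons (fcons y u) z) =
  [forall a, y 0 a *: rank1 u + slab a (\sum_j rank1 (z j)) \in U].
Proof.
have sumE : \sum_j rank1 (fcons (fcons y u) z j) = rank1 (fcons y u) + \sum_j rank1 (z j).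
  by rewrite big_ord_recl fcons0; congr (_ + _); apply: eq_bigr => j _; rewrite fconsS.
rewrite /sum_rank1_in /= sumE.
by apply: eq_forallb => a; rewrite slabD slab_rank1.
Qed.

(* Reveal the tensors one by one. If [rank1 u] lies in [U], the vector [y] is
   free; otherwise at most one [y] works, and the remaining sum lies in
   [U + <[rank1 u]>]. *)
Lemma card_sum_rank1_in (R : realType) (D k r t : nat) (p : R)
    (U : {vspace multitensor D k}) :
  (forall V : {vspace multitensor D k}, (\dim V < r)%N ->
    #|[pred u : vectors D k | rank1 u \in V]|%:R <= 2 ^+ (k * D) * p) ->
  0 <= p -> (\dim U + t <= r)%N ->
  #|@sum_rank1_in D k t U|%:R <= (2 ^+ (k * D) * (p * 2 ^+ k + 1)) ^+ t.
Proof.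
move=> Hp p0; set B := _ * (_ + 1).
have B0 : 0 <= B by rewrite mulr_ge0 ?addr_ge0 ?mulr_ge0 ?exprn_ge0.
elim: t => [|t IH] in U *.
  move=> _; rewrite expr0 -[1]/(1%:R) ler_nat (leq_trans (max_card _)) //.
  by rewrite card_ffun card_ord expn0.
rewrite addnS => dimU; have Bt : 0 <= B ^+ t by rewrite exprn_ge0.
have -> : #|@sum_rank1_in D k t.+1 U| =
    (\sum_(u : vectors D k) \sum_(z : {ffun 'I_t -> vectors D.+1 k})
      #|[pred y : 'rV['F_2]_k | sum_rank1_in U (fcons (fcons y u) z)]|)%N.
  rewrite -sum1_card big_mkcond /= sum_fcons sum_fcons exchange_big /=.
  apply: eq_bigr => u _; rewrite exchange_big /=; apply: eq_bigr => z _.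
  by rewrite -sum1_card [RHS]big_mkcond.
rewrite natr_sum (bigID (fun u => rank1 u \in U)) /=.
(* First term: [rank1 u] in [U], a proportion at most [p], with all 2^k vectors [y] allowed. Second
   term: any [u], with at most one [y] per [z]. *)
apply: (@le_trans _ _ (2 ^+ (k * D) * p * (2 ^+ k * B ^+ t) + 2 ^+ (k * D) * B ^+ t)); last first.
  by rewrite exprS /B le_eqVlt; apply/orP; left; apply/eqP; ring.
apply: lerD.
  apply: (@le_trans _ _ (\sum_(u : vectors D k | rank1 u \in U) 2 ^+ k * B ^+ t)).
    apply: ler_sum => u uU.
    apply: (@le_trans _ _ (2 ^+ k * #|@sum_rank1_in D k t U|%:R)); last first.
      by rewrite ler_wpM2l ?exprn_ge0 // IH // (leq_trans _ dimU) // leqnSn.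
    rewrite -natrX -natrM ler_nat -sum1_card big_distrr /= [leqRHS]big_mkcond /=.
    apply: leq_sum => z _; case: ifP => zU.
      by rewrite muln1 (leq_trans (max_card _)) // card_mx card_Fp // mul1n.
    rewrite leqn0; apply/eqP/eq_card0 => y; rewrite inE sum_rank1_in_fcons.
    apply: contraFF zU => /forallP H; apply/forallP => a.
    by rewrite -(rpredDl _ (memvZ (y 0 a) uU)) H.
  rewrite sumr_const -[_ *+ #|_|]mulr_natl ler_wpM2r ?mulr_ge0 ?exprn_ge0 //.
  by apply: Hp; rewrite (leq_trans _ dimU) // ltnS leq_addr.
apply: (@le_trans _ _ (\sum_(u : vectors D k | rank1 u \notin U) B ^+ t)); last first.
  rewrite sumr_const -[_ *+ #|_|]mulr_natl ler_wpM2r // -natrX ler_nat.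
  by rewrite (leq_trans (max_card _)) // card_vectors.
apply: ler_sum => u uU; apply: le_trans (IH (U + <[rank1 u]>)%VS _); last first.
  rewrite (leq_trans _ dimU) // -addSn leq_add2r.
  rewrite (leq_trans (dimv_add_leqif _ _)) // dim_vline -[leqRHS]addn1 leq_add2l.
  exact: leq_b1.
rewrite ler_nat -sum1_card [leqRHS]big_mkcond /=.
apply: leq_sum => z _; case: ifP => zU.
  (* Subtracting the two conditions puts a multiple of [rank1 u] in [U]; as [rank1 u] is outside,
     the scalar, a coordinate of the difference of [y] and [y'], is 0. *)
  apply/card_le1_eqP => y y'; rewrite !inE !sum_rank1_in_fcons => /forallP yU /forallP y'U.
  apply/rowP => a; apply/eqP; rewrite -subr_eq0.
  have := memvB (y'U a) (yU a); rewrite opprD addrACA subrr addr0 -scalerBl rpredZeq.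
  by rewrite (negPf uU) orbF.

rewrite leqn0; apply/eqP/eq_card0 => y; rewrite inE sum_rank1_in_fcons.
apply: contraFF zU => /forallP H; apply/forallP => a.
rewrite -[slab _ _](addKr (y 0 a *: rank1 u)) addrC memv_add ?H //.
by rewrite -scaleNr memvZ ?memv_line.
Qed.

(** * Signs and moments of the bias *)

Definition sgn2 (R : realType) (a : 'F_2) : R := (-1) ^+ nat_of_ord a.

Lemma sgn2D (R : realType) (a b : 'F_2) : sgn2 R (a + b) = sgn2 R a * sgn2 R b.
Proof.
rewrite /sgn2 -exprD.
by case: a b => [[|[|a]] ?] [[|[|b]] ?] //=; rewrite ?expr0 ?sqrrN ?expr1n.
Qed.

Lemma sgn2_sum (R : realType) (I : Type) (r : seq I) (P : pred I) (F : I -> 'F_2) :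
  sgn2 R (\sum_(i <- r | P i) F i) = \prod_(i <- r | P i) sgn2 R (F i).
Proof. by apply: (big_morph (@sgn2 R) (@sgn2D R)). Qed.

Lemma sum_sgn2_mul (R : realType) (c : 'F_2) :
  \sum_(b : 'F_2) sgn2 R (b * c) = if c == 0 then 2 else 0.
Proof.
rewrite !big_ord_recl big_ord0 addr0 mul0r.
have -> : lift ord0 ord0 = 1 :> 'F_2 by exact/val_inj.
rewrite mul1r {1}/sgn2 expr0.
by case: c => [[|[|c]] ?] //=; rewrite /sgn2 /= ?expr0 ?expr1 ?subrr.
Qed.

(** Orthogonality of characters: the sum factors over the coordinates, and one nonzero [c i] makes
    its factor 0. *)
Lemma sum_sgn2_dot (R : realType) (I : finType) (c : I -> 'F_2) :
  \sum_(T : {ffun I -> 'F_2}) sgn2 R (\sum_i T i * c i) =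
  if [forall i, c i == 0] then 2 ^+ #|I| else 0.
Proof.
under eq_bigr do rewrite sgn2_sum.
rewrite -(bigA_distr_bigA (fun i b => sgn2 R (b * c i))).
under eq_bigr do rewrite sum_sgn2_mul.
case: forallP => [c0|/forallP]; last first.
  by rewrite negb_forall => /existsP[i /negPf ci]; rewrite (bigD1 i) //= ci mul0r.
under eq_bigr do rewrite c0.
by rewrite prodr_const.
Qed.

Lemma mlform_rank1 (D k : nat) (T : tensor D k) (x : vectors D k) :
  mlform T x = \sum_i T i * rank1 x i.
Proof. by apply: eq_bigr => i _; rewrite ffunE. Qed.

Lemma sum_sgn2_mlform_ge0 (R : realType) (D k : nat) (T : tensor D.+1 k) :
  0 <= \sum_(x : vectors D.+1 k) sgn2 R (mlform T x).
Proof.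
rewrite sum_fcons exchange_big /=; apply: sumr_ge0 => u _.
pose c a : 'F_2 := \sum_i T (fcons a i) * rank1 u i.
have rowK : {on predT, bijective (fun f : {ffun 'I_k -> 'F_2} => \row_a f a)}.
  apply: onW_bij; exists (fun y : 'rV['F_2]_k => [ffun a => y 0 a]) => [f|y].
    by apply/ffunP => a; rewrite ffunE mxE.
  by apply/rowP => a; rewrite mxE ffunE.
rewrite (reindex _ rowK) /=.
have -> : \sum_(f : {ffun 'I_k -> 'F_2}) sgn2 R (mlform T (fcons (\row_a f a) u)) =
    \sum_(f : {ffun 'I_k -> 'F_2}) sgn2 R (\sum_a f a * c a).
  apply: eq_bigr => f _; congr (sgn2 R _).
  rewrite mlform_rank1 sum_fcons; apply: eq_bigr => a _.
  rewrite mulr_sumr; apply: eq_bigr => i _.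
  by rewrite rank1_fcons tensl_fcons mxE mulrCA.
by rewrite sum_sgn2_dot; case: ifP => // _; rewrite exprn_ge0.
Qed.

(** Expanding the power gives the sign of the pairing of [T] with the sum of the [rank1 (z j)];
    summing over [T] leaves only the tuples where that sum is 0. *)
Lemma sum_sgn2_mlform_pow (R : realType) (D k t : nat) :
  \sum_(T : tensor D k) (\sum_(x : vectors D k) sgn2 R (mlform T x)) ^+ t =
  #|tensor D k|%:R
    * #|[pred z : {ffun 'I_t -> vectors D k} | \sum_j rank1 (z j) == 0]|%:R.
Proof.
have powE (T : tensor D k) : (\sum_(x : vectors D k) sgn2 R (mlform T x)) ^+ t =
    \sum_(z : {ffun 'I_t -> vectors D k}) sgn2 R (\sum_i T i * (\sum_j rank1 (z j)) i).
  rewrite -[in LHS](card_ord t) -prodr_const bigA_distr_bigA /=.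
  apply: eq_bigr => z _; rewrite -sgn2_sum; congr (sgn2 R _).
  rewrite (eq_bigr _ (fun j _ => mlform_rank1 T (z j))).
  rewrite exchange_big /=; apply: eq_bigr => i _.
  by rewrite sum_ffunE mulr_sumr.
under eq_bigr do rewrite powE.
rewrite exchange_big /= -[X in _ * X%:R]sum1_card natr_sum mulr_sumr [RHS]big_mkcond /=.
apply: eq_bigr => z _.
rewrite (sum_sgn2_dot R (fun i => (\sum_j rank1 (z j)) i)) mulr1.
have -> : #|tensor D k|%:R = 2 ^+ #|{ffun 'I_D -> 'I_k}| :> R.
  by rewrite [#|tensor D k|]card_ffun card_Fp // natrX.
rewrite !inE; congr (if _ then _ else _).
apply/forallP/eqP => [z0|-> i]; last by rewrite ffunE.
by apply/ffunP => i; rewrite (eqP (z0 i)) ffunE.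
Qed.

(** * Tail bound for the bias *)

Lemma bias_mlform (R : realType) (D k : nat) (T : tensor D.+1 k) :
  bias R (mlform T) =
  (\sum_(x : vectors D.+1 k) sgn2 R (mlform T x)) / 2 ^+ (k * D.+1).
Proof.
rewrite /bias /expect card_vectors natrX ger0_norm //.
by rewrite divr_ge0 ?exprn_ge0 // sum_sgn2_mlform_ge0.
Qed.

Lemma bias_le1 (R : realType) (D k : nat) (f : vectors D k -> 'F_2) : bias R f <= 1.
Proof.
have N_gt0 : 0 < #|vectors D k|%:R :> R by rewrite card_vectors natrX exprn_gt0.
rewrite /bias /expect normrM normfV [`|#|_|%:R|]gtr0_norm // ler_pdivrMr // mul1r.
rewrite (le_trans (ler_norm_sum _ _ _)) //.
under eq_bigr do rewrite normrX normrN1 expr1n.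
by rewrite sumr_const.
Qed.

(** Markov's inequality for the moment of order t + 1: the subspace starts at 0 and gains at most
    one dimension per step, so its dimension is at most [t] whenever a tensor is tested. *)
Lemma prob_bias_le (R : realType) (D k t : nat) (b : R) :
  (0 < k)%N -> 0 < b ->
  prob R (fun T : tensor D.+1 k => b <= bias R (mlform T))
  <= ((D%:R / 2 ^+ k + (2 `^ (k%:R * t%:R / k%:R ^+ D) - 1) / (2 ^+ k - 1)
       + (2 ^+ k)^-1) / b) ^+ t.+1.
Proof.
move=> k_gt0 b_gt0; set E := _ - 1; set p := D%:R / _ + E / _.
have c_gt0 : 0 < 2 ^+ k - 1 :> R by rewrite subr_gt0 exprn_egt1 // ?ltr1n // -lt0n.
have E0 : 0 <= E.
  by rewrite subr_ge0 -[leLHS](powRr0 2) ler_powR2 // divr_ge0 ?mulr_ge0 ?exprn_ge0.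
have p0 : 0 <= p by rewrite addr_ge0 // divr_ge0 ?exprn_ge0 // ltW.
have tens_gt0 : 0 < #|tensor D.+1 k|%:R :> R.
  by rewrite [#|tensor _ _|]card_ffun card_Fp // natrX exprn_gt0.
rewrite /prob; set P : pred (tensor D.+1 k) := fun T => _.
rewrite ler_pdivrMr // expr_div_n mulrAC ler_pdivlMr ?exprn_gt0 //.
apply: (@le_trans _ _ (\sum_(T : tensor D.+1 k) bias R (mlform T) ^+ t.+1)).
  rewrite mulr_natl -sumr_const big_mkcond /=; apply: ler_sum => T _.
  case: ifP => PT; last by rewrite exprn_ge0 // normr_ge0.
  by rewrite lerXn2r ?nnegrE ?normr_ge0 // ltW.
under eq_bigr do rewrite bias_mlform expr_div_n.
rewrite -mulr_suml sum_sgn2_mlform_pow [leRHS]mulrC -mulrA.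
rewrite ler_wpM2l ?ler0n // ler_pdivrMr ?exprn_gt0 // -exprMn.
have -> : (p + (2 ^+ k)^-1) * 2 ^+ (k * D.+1) = 2 ^+ (k * D) * (p * 2 ^+ k + 1).
  by rewrite mulnS exprD; field; rewrite gt_eqF // exprn_gt0.
apply: le_trans (@card_sum_rank1_in R D k t.+1 t.+1 p 0%VS _ p0 _).
- rewrite ler_nat; apply: subset_leq_card; apply/fintype.subsetP => z.
  rewrite !inE => /eqP ->; apply/forallP => a; rewrite memv0.
  by apply/eqP/ffunP => i; rewrite !ffunE.
- move=> V; rewrite ltnS => dV; apply: le_trans (card_rank1 R V k_gt0) _.
  rewrite ler_wpM2l ?exprn_ge0 // lerD2l ler_wpM2r ?invr_ge0 ?(ltW c_gt0) //.
  rewrite lerB // ler_powR2 // ler_wpM2r ?invr_ge0 ?exprn_ge0 //.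
  by rewrite ler_wpM2l // ler_nat.
- by rewrite dimv0.
Qed.

Theorem theorem3p2 (R : realType) :
  exists2 c : R, 0 < c &
    forall (eps : R) (d k : nat),
      0 < eps -> (0 < d)%N ->
      d%:R < 2 `^ (eps * k%:R / 5) ->
      prob R (fun T : tensor d k =>
                2 `^ (- ((1 - eps) * k%:R)) <= bias R (mlform T))
      <= 2 `^ (- (c * eps ^+ 2 * (k ^ d)%:R)).
Proof.
(* The base is at most 2^(-3/5 eps k) and the order of the moment exceeds eps k^(d-1) / 5; the
   constant is 3/5 times 1/5. *)
exists (3 / 25); first by lra.
move=> eps d k eps0 d_gt0 d_lt; case: d d_gt0 d_lt => // D _ d_lt.
have k_gt0 : (0 < k)%N.
  case: k d_lt => //; rewrite mulr0 mul0r powRr0 -[1]/(1%:R) ltr_nat //.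
have k0 : 0 < k%:R :> R by rewrite ltr0n.
(* For eps > 1 the threshold exceeds 1, hence every bias. *)
have [eps_gt1|eps_le1] := ltP 1 eps.
  rewrite /prob (@eq_card0 _ (fun T => _)) ?mul0r ?powR_ge0 // => T.
  apply/negbTE; rewrite -ltNge; apply: le_lt_trans (bias_le1 R (mlform T)) _.
  rewrite -mulNr opprB /powR pnatr_eq0 /= expR_gt1 !mulr_gt0 ?subr_gt0 //.
  by rewrite ln_gt0 // ltr1n.
have powk (x : R) : 2 `^ (x - k%:R) = 2 `^ x / 2 ^+ k.
  by rewrite powR2D powRN powR_mulrn.
have bE : 2 `^ (- ((1 - eps) * k%:R)) = 2 `^ (eps * k%:R - k%:R) :> R.
  by congr (_ `^ _); ring.
set b := 2 `^ (- ((1 - eps) * k%:R)) in bE *; have b_gt0 : 0 < b by rewrite powR_gt0.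
have ratio m : 2 `^ (m - k%:R) / b = 2 `^ (m - eps * k%:R).
  by rewrite bE -powRN -powR2D; congr (_ `^ _); ring.
(* The case d = 1 is apart, since [e5] rests on 2 <= d: here the first moment already gives 2^(-eps
   k). *)
case: D d_lt => [|D] d_lt.
  apply: le_trans (prob_bias_le 0 0 k_gt0 b_gt0) _.
  rewrite mulr0 mul0r powRr0 subrr !mul0r !add0r expr1 -[(2 ^+ k)^-1]mul1r.
  rewrite -[X in X / 2 ^+ k](powRr0 2) -powk ratio expn1 ler_powR2 //.
  have ek0 : 0 <= eps * k%:R by rewrite mulr_ge0 ?ltW.
  have : 0 <= eps * k%:R * (1 - eps) by rewrite mulr_ge0 // subr_ge0.
  nra.
set e := eps * k%:R in d_lt ratio *.
(* This absorbs the factor 2 of 2 * 2^(e/5) into 2^(2e/5). *)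
have e5 : 5 < e.
  rewrite ltNge; apply/negP => e5.
  have : 2 `^ (e / 5) <= 2 `^ 1 :> R by rewrite ler_powR2 //; lra.
  rewrite powRr1 // => /(lt_le_trans d_lt).
  by rewrite ltr_nat.
pose y := eps * k%:R ^+ D.+1 / 5.
have y0 : 0 <= y by rewrite divr_ge0 // mulr_ge0 ?exprn_ge0 // ltW.
(* t <= y keeps the exponent [a] below e / 5, while t + 1 > y gives the final exponent. *)
have /andP[t_le t_gt] := truncn_itv y0; set t := Num.truncn y in t_le t_gt.
apply: le_trans (prob_bias_le D.+1 t k_gt0 b_gt0) _.
have A_le : k%:R * t%:R / k%:R ^+ D.+1 <= e / 5.
  rewrite ler_pdivrMr ?exprn_gt0 //.
  have -> : e / 5 * k%:R ^+ D.+1 = k%:R * y by rewrite /e /y; ring.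
  by rewrite ler_pM2l.
have base0 : 0 <= 2 `^ (k%:R * t%:R / k%:R ^+ D.+1) - 1 :> R.
  by rewrite subr_ge0 -[leLHS](powRr0 2) ler_powR2 // divr_ge0 ?mulr_ge0 ?exprn_ge0.
set a := _ / _ ^+ D.+1 in A_le base0 *.
have Q_gt1 : 1 < 2 ^+ k :> R by rewrite exprn_egt1 ?ltr1n // -lt0n.
have base_ge0 : 0 <= (D.+1%:R / 2 ^+ k + (2 `^ a - 1) / (2 ^+ k - 1) + (2 ^+ k)^-1) / b.
  apply: divr_ge0 (ltW b_gt0); rewrite addr_ge0 ?invr_ge0 ?exprn_ge0 //.
  by rewrite addr_ge0 ?divr_ge0 ?exprn_ge0 // subr_ge0 ltW.
have Q_gt0 := lt_trans ltr01 Q_gt1.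
have base_le : (D.+1%:R / 2 ^+ k + (2 `^ a - 1) / (2 ^+ k - 1) + (2 ^+ k)^-1) / b
    <= 2 `^ (- (3 / 5 * e)).
  have -> : - (3 / 5 * e) = 2 / 5 * e - e by field.
  rewrite -ratio ler_pM2r ?invr_gt0 // powk.
  have aQ : 2 `^ a <= 2 ^+ k :> R.
    rewrite -powR_mulrn // ler_powR2 // (le_trans A_le) //.
    have : e <= k%:R by rewrite /e ler_piMl // ltW.
    by move: k0; lra.
  (* As 2^a <= 2^k, lowering numerator and denominator by 1 does not increase the ratio. Then d and
     2^a are each at most 2^(e/5). *)
  apply: (@le_trans _ _ ((D.+2%:R + 2 `^ a) / 2 ^+ k)).
    rewrite -[D.+2%:R]natr1 (addrAC _ 1) [leRHS]mulrDl [in leRHS]mulrDl mul1r lerD2r lerD2l.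
    rewrite ler_pdivrMr ?subr_gt0 // mulrBr mulr1 divfK ?gt_eqF // lerB //.
    by rewrite ler_pdivrMr ?mul1r.
  rewrite ler_pM2r ?invr_gt0 //.
  apply: (@le_trans _ _ (2 `^ (e / 5) + 2 `^ (e / 5))).
    by rewrite lerD ?ler_powR2 // ltW.
  have -> : 2 / 5 * e = e / 5 + e / 5 by field.
  rewrite powR2D -mulr2n -[leLHS]mulr_natl ler_wpM2r ?powR_ge0 //.
  rewrite -[leLHS]powRr1 // ler_powR2 //; lra.
apply: (@le_trans _ _ ((2 `^ (- (3 / 5 * e))) ^+ t.+1)).
  by rewrite lerXn2r ?nnegrE ?powR_ge0.
rewrite -powR_mulrn ?powR_ge0 // -powRrM ler_powR2 //.
have -> : - (3 / 25 * eps ^+ 2 * (k ^ D.+2)%:R) = - (3 / 5 * e) * y.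
  by rewrite natrX [k%:R ^+ D.+2]exprS /e /y; field.
by rewrite ler_wnM2l // ?ltW //; lra.
Qed.
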